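(* Let $G$ be a bridgeless cubic graph containing a 2-factor having at most two cycles. If $G$ is not the Petersen graph, then there is a perfect matching $F$ of $G$ such that $G/\overline{F}$ admits a non-conflicting nowhere-zero $\mathbb{Z}_2\times\mathbb{Z}_2$-flow with respect to $\overline{F}$.
   Context: Graphs are finite, loopless, and may have parallel edges. For a perfect matching $F$ of a cubic graph $G$, $\overline{F}=G-F$ is the complementary 2-factor, and $G/\overline{F}$ is the pseudo-graph obtained by contracting each cycle of $\overline{F}$ to a vertex; its edges are the edges of $F$ (edges of $F$ with both ends on one cycle become loops). Write $\mathbb{Z}_2\times\mathbb{Z}_2=\{0,\alpha,\beta,\alpha+\beta\}$. A nowhere-zero $\mathbb{Z}_2\times\mathbb{Z}_2$-flow is an assignment $\theta$ of nonzero elements to the edges such that at every vertex the sum of values on incident edges is $0$ (loops counted twice). Such a flow of $G/\overline{F}$ is non-conflicting with respect to $\overline{F}$ if no edge $uv$ of $\overline{F}$ has $u$ incident to an edge of $F$ with value $\alpha$ and $v$ incident to an edge of $F$ with value $\beta$. *)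

(* Defs.v *)
From HB Require Import structures.
From mathcomp Require Import all_boot all_order all_algebra.

Set Implicit Arguments.
Unset Strict Implicit.
Unset Printing Implicit Defensive.

Import GRing.Theory.
Local Open Scope ring_scope.

(* A finite undirected graph, possibly with loops and parallel edges. The
   order of the two ends of an edge carries no meaning. *)
Record pseudograph := Pseudograph {
  vertex : finType;
  edge : finType;
  end1 : edge -> vertex;
  end2 : edge -> vertex }.

Section Pseudograph.
Variable G : pseudograph.
Implicit Types (A F : {set edge G}) (e : edge G) (x y : vertex G).

Definition loopless : Prop := forall e, end1 e != end2 e.

Definition incident x e : bool := (end1 e == x) || (end2 e == x).

Definition joins e x y : bool :=
  (end1 e == x) && (end2 e == y) || (end1 e == y) && (end2 e == x).

(* Degree in the spanning subgraph with edge set A; a loop counts twice. *)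
Definition degree A x : nat :=
  (#|[set e in A | end1 e == x]| + #|[set e in A | end2 e == x]|)%N.

Definition regular (k : nat) A : Prop := forall x, degree A x = k.

Definition cubic : Prop := regular 3 [set: edge G].

Definition perfect_matching F : Prop := regular 1 F.

Definition two_factor A : Prop := regular 2 A.

Definition adjacent A : rel (vertex G) := fun x y => [exists e in A, joins e x y].

(* Vertex sets of the connected components of the spanning subgraph with edge
   set A. When A is a 2-factor, these are the vertex sets of its cycles. *)
Definition component A x : {set vertex G} := [set y | connect (adjacent A) x y].

Definition components A : {set {set vertex G}} := [set component A x | x : vertex G].

Definition bridge e : Prop :=
  (#|components [set: edge G]| < #|components [set~ e]|)%N.

Definition bridgeless : Prop := forall e, ~ bridge e.

Lemma mem_components A x : component A x \in components A.
Proof. exact: imset_f. Qed.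

(* G / A: each component of (vertex G, A) is contracted to a single vertex;
   the edges are those outside A, possibly becoming loops. *)
Definition contract A : pseudograph :=
  @Pseudograph {C : {set vertex G} | C \in components A} {e : edge G | e \notin A}
    (fun d => exist _ (component A (end1 (val d))) (mem_components A (end1 (val d))))
    (fun d => exist _ (component A (end2 (val d))) (mem_components A (end2 (val d)))).

End Pseudograph.

Definition Z2xZ2 : zmodType := ('Z_2 * 'Z_2)%type.
Definition alpha : Z2xZ2 := (1, 0).
Definition beta : Z2xZ2 := (0, 1).

(* Each end of an edge contributes its value, so a loop is counted twice. *)
Definition nowhere_zero_flow (H : pseudograph) (theta : edge H -> Z2xZ2) : Prop :=
  (forall e, theta e != 0) /\
  (forall x, \sum_(e | end1 e == x) theta e + \sum_(e | end2 e == x) theta e = 0).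

Definition non_conflicting (G : pseudograph) (A : {set edge G})
    (theta : edge (contract A) -> Z2xZ2) : Prop :=
  ~ exists (e : edge G) (u v : vertex G) (f g : edge (contract A)),
      [/\ e \in A, joins e u v,
          incident u (val f) /\ theta f = alpha &
          incident v (val g) /\ theta g = beta].

Definition isomorphic (G H : pseudograph) : Prop :=
  exists (f : vertex G -> vertex H) (g : edge G -> edge H),
    [/\ bijective f, bijective g &
        forall e, joins (g e) (f (end1 e)) (f (end2 e))].

(* Outer pentagon on the vertices inl i, inner pentagram on the vertices inr i.
   The three summands of the edge type are the sides of the pentagon, the
   spokes, and the sides of the pentagram; indices are taken modulo 5. *)
Definition petersen : pseudograph :=
  @Pseudograph ('Z_5 + 'Z_5)%type ('Z_5 + 'Z_5 + 'Z_5)%type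
    (fun e => match e with
              | inl (inl i) => inl i
              | inl (inr i) => inl i
              | inr i => inr i
              end)
    (fun e => match e with
              | inl (inl i) => inl (i + 1)
              | inl (inr i) => inr i
              | inr i => inr (i + 2%:R)
              end).

(* Main.v *)
Require Import Defs.
From mathcomp Require Import all_boot all_order all_algebra.

(* It suffices to find a perfect matching F and a pair (H1, H2) of even subgraphs
   of G that cover F and satisfy the non-conflict condition for the values
   alpha (only H1), beta (only H2), alpha + beta (both) on F.

   If the cycles of the given 2-factor A are even, take F = E - A, H1 = F plus
   a perfect matching of A, and H2 empty. Otherwise A consists of two odd cycles
   C1, C2. Choose an edge uv outside A joining them, let F consist of uv and the
   perfect matchings of C1 - u and C2 - v contained in A, and let H2 = C1 + C2, so
   that uv is the only edge of F outside H2. It remains to find an even subgraph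
   H1 containing uv and the edges of F next to u and v. Writing a(x) for the set
   of edges outside A at the A-neighbours of x, a set S of edges outside A with uv
   in S extends by arcs of C1 and C2 to such an H1 as soon as it has an even number
   of edges between C1 and C2 and an odd number of edges in both a(u) and a(v)
   (when a(v) is a single chord, v lies on a triangle and F and H2 are modified
   there). By linear algebra over F_2 such an S exists unless the symmetric
   difference of a(u) and a(v) is the set of all other edges between C1 and C2. If
   this happens for every choice of uv, then C1 and C2 are induced pentagons whose
   adjacencies are complementary under the matching, so G is the Petersen graph. *)

Set Implicit Arguments.
Unset Strict Implicit.
Unset Printing Implicit Defensive.

(** * Flows, boundaries and T-joins *)

Section Boundary.
Import GRing.Theory.
Local Open Scope ring_scope.
Variable G : pseudograph.
Implicit Types (A F X : {set edge G}) (C : {set vertex G}).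

(** With [V = bool], whose addition is exclusive or, this is the parity of the degree at [x]: an
    even subgraph is a [phi : edge G -> bool] with zero boundary everywhere. *)
Definition boundary (V : zmodType) (phi : edge G -> V) (x : vertex G) : V :=
  \sum_(e | end1 e == x) phi e + \sum_(e | end2 e == x) phi e.

Lemma boundaryD (V : zmodType) (phi psi : edge G -> V) x :
  boundary (fun e => phi e + psi e) x = boundary phi x + boundary psi x.
Proof. by rewrite /boundary !big_split addrACA. Qed.

Lemma boundary_sum (V : zmodType) (I : finType) (P : pred I)
    (phi : I -> edge G -> V) x :
  boundary (fun e => \sum_(i | P i) phi i e) x = \sum_(i | P i) boundary (phi i) x.
Proof. by rewrite /boundary exchange_big [X in _ + X]exchange_big -big_split. Qed.

Lemma eq_boundary (V : zmodType) (phi psi : edge G -> V) x :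
  (forall e, incident x e -> phi e = psi e) -> boundary phi x = boundary psi x.
Proof.
move=> eq_phi; congr (_ + _); apply: eq_bigr => e ex; apply: eq_phi.
  by rewrite /incident ex.
by rewrite /incident ex orbT.
Qed.

Lemma sum_symdiff (V : zmodType) (char2 : forall a : V, a + a = 0)
    (I : finType) (P Q : pred I) (phi : I -> V) :
  \sum_(i | P i) phi i + \sum_(i | Q i) phi i = \sum_(i | P i (+) Q i) phi i.
Proof.
rewrite big_mkcond [X in _ + X]big_mkcond [RHS]big_mkcond -big_split.
by apply: eq_bigr => i _; case: (P i); case: (Q i); rewrite /= ?char2 ?addr0 ?add0r.
Qed.

(** In characteristic 2 an edge with both ends in [C] contributes twice and cancels, so only the
    edge cut of [C] survives. *)
Lemma handshake (V : zmodType) (char2 : forall a : V, a + a = 0)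
    (phi : edge G -> V) C :
  \sum_(x in C) boundary phi x =
  \sum_(e | (end1 e \in C) (+) (end2 e \in C)) phi e.
Proof.
rewrite big_split -sum_symdiff //; congr (_ + _).
  rewrite [RHS](partition_big (@end1 G) (mem C)) //; apply: eq_bigr => x xC.
  by apply: eq_bigl => e; case: eqP => [->|]; rewrite ?andbF ?andbT // xC.
rewrite [RHS](partition_big (@end2 G) (mem C)) //; apply: eq_bigr => x xC.
by apply: eq_bigl => e; case: eqP => [->|]; rewrite ?andbF ?andbT // xC.
Qed.

Lemma Z2xZ2_char2 (a : Z2xZ2) : a + a = 0.
Proof. by apply/eqP; case: a => [] [[|[|//]] i] [[|[|//]] j]. Qed.

Lemma adjacentP A x y :
  reflect (exists2 e, e \in A & joins e x y) (adjacent A x y).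
Proof.
apply: (iffP existsP) => [[e /andP[]]|[e eA exy]]; first by exists e.
by exists e; rewrite eA.
Qed.

Lemma joinsC (e : edge G) x y : joins e x y = joins e y x.
Proof. by rewrite /joins orbC. Qed.

Lemma adjacent_sym A : symmetric (adjacent A).
Proof. by move=> x y; apply: eq_existsb => e; rewrite joinsC. Qed.

Lemma connect_adjacentC A : connect_sym (adjacent A).
Proof. exact: sym_connect_sym (@adjacent_sym A). Qed.

Lemma component_end A C e :
  C \in components A -> e \in A -> (end1 e \in C) = (end2 e \in C).
Proof.
case/imsetP=> x _ -> eA; rewrite !inE.
apply: same_connect_r; first exact: connect_adjacentC.
by apply: connect1; apply/adjacentP; exists e; rewrite // /joins !eqxx.
Qed.

(** Summing the zero boundaries over a contracted component leaves its edge cut by [handshake].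
    Edges outside [F] never leave a component, so the cut lies in [F], and restricting [phi] to [F]
    keeps flow conservation; a loop of the contraction cancels against itself. *)
Lemma flow_on_contraction F (phi : edge G -> Z2xZ2) :
    (forall x, boundary phi x = 0) -> (forall e, e \in F -> phi e != 0) ->
    (forall e u v f g, e \notin F -> joins e u v -> f \in F -> g \in F ->
       incident u f -> incident v g -> phi f = alpha -> phi g <> beta) ->
  exists theta : edge (contract (~: F)) -> Z2xZ2,
    nowhere_zero_flow theta /\ non_conflicting theta.
Proof.
move=> phi0 phiF phi_nc; exists (fun d => phi (val d)); split; last first.
  case=> e [u [v [d [d' ]]]].
  have := valP d; have := valP d'; rewrite !inE !negbK => gF fF.
  case=> eF euv [uf f_al] [vg g_be].
  exact: (phi_nc e u v _ _ eF euv fF gF uf vg f_al g_be).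
split=> [[d dF]|[C CA]] /=; first by apply: phiF; rewrite inE negbK in dF.
have sumF (P : pred (edge G)) (Q : pred {e | e \notin ~: F}) :
    (forall d, Q d = P (val d)) ->
    \sum_(d : {e | e \notin ~: F} | Q d) phi (val d) = \sum_(e | (e \in F) && P e) phi e.
  move=> QP; rewrite (eq_bigl _ _ QP) [LHS]big_mkcond.
  rewrite -(@big_sub _ _ _ _ (fun e => e \notin ~: F) (fun e => if P e then phi e else 0)).
  rewrite -big_mkcondr; apply: eq_bigl => e.
  by rewrite unfold_in inE negbK.
rewrite (sumF (fun e => end1 e \in C)); last first.
  move=> d; apply/eqP/idP => [[<-]|dC]; first by rewrite inE connect0.
  apply/val_inj => /=; case/imsetP: CA dC => x _ ->; rewrite inE => xd.
  by apply/setP=> y; rewrite !inE (same_connect (@connect_adjacentC _) xd).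
rewrite (sumF (fun e => end2 e \in C)); last first.
  move=> d; apply/eqP/idP => [[<-]|dC]; first by rewrite inE connect0.
  apply/val_inj => /=; case/imsetP: CA dC => x _ ->; rewrite inE => xd.
  by apply/setP=> y; rewrite !inE (same_connect (@connect_adjacentC _) xd).
rewrite sum_symdiff; last exact: Z2xZ2_char2.
have := handshake Z2xZ2_char2 phi C; rewrite big1 // => sum0; rewrite [RHS]sum0.
apply: eq_bigl => e; have [|eF] := boolP (e \in F); first by case: (_ \in C).
rewrite (component_end CA) ?addbb //.
by rewrite inE.
Qed.

Lemma boundary_pred1 (d : edge G) z :
  boundary (fun e => e == d) z = (end1 d == z) (+) (end2 d == z).
Proof.
rewrite /boundary; congr (_ (+) _).
  rewrite big_mkcond (bigD1 d) //= eqxx big1 ?addr0; first by case: ifP.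
  by move=> e /negPf->; case: ifP.
rewrite big_mkcond (bigD1 d) //= eqxx big1 ?addr0; first by case: ifP.
by move=> e /negPf->; case: ifP.
Qed.

(** Edges of a walk are added modulo 2, so the walk need not be simple. *)
Lemma path_join A x y : connect (adjacent A) x y ->
  exists2 h : edge G -> bool,
    forall e, h e -> e \in A & forall z, boundary h z = (x == z) (+) (y == z).
Proof.
case/connectP=> p; elim: p x => [|x' p IHp] x /=.
  move=> _ ->; exists (fun _ => false) => // z.
  by rewrite addbb /boundary !big1.
case/andP=> /adjacentP[d dA dx] /IHp IH /IH[h hA hb].
exists (fun e => (e == d) + h e) => [e|z].
  have [->//|_] := eqVneq e d; exact: hA.
rewrite boundaryD hb boundary_pred1.
case/orP: dx => /andP[/eqP-> /eqP->] /=.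
  by do 3 case: (_ == z).
by do 3 case: (_ == z).
Qed.

(* Each vertex [x] of [T] contributes a path from [x] to the root of its
   component. *)
Lemma T_join A (T : vertex G -> bool) :
    (forall C, C \in components A -> \sum_(x in C) T x = 0) ->
  exists2 h : edge G -> bool,
    forall e, h e -> e \in A & forall z, boundary h z = T z.
Proof.
move=> T0; pose r := fingraph.root (adjacent A).
have /fin_all_exists2[h hA hb] : forall x, exists2 h : edge G -> bool,
    forall e, h e -> e \in A & forall z, boundary h z = (x == z) (+) (r x == z).
  by move=> x; apply: path_join; apply: connect_root.
exists (fun e => \sum_(x | T x) h x e) => [e|z].
  apply: contraTT => eA; rewrite big1 // => x _.
  by apply: contraNF eA => /hA.
rewrite boundary_sum (eq_bigr _ (fun x _ => hb x z)) big_split /=.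
have -> : \sum_(x | T x) (x == z) = T z.
  rewrite big_mkcond (bigD1 z) //= eqxx big1 ?addr0; first by case: (T z).
  by move=> x /negPf->; case: ifP.
(* The far ends of the paths pile up at roots. A root receives one path for each vertex of [T] in
   its component, hence an even number. *)
suff -> : \sum_(x | T x) (r x == z) = false by rewrite addr0.
rewrite big_mkcond /=.
have [rz|rz] := eqVneq (r z) z; last first.
  rewrite big1 // => x _; case: ifP => // _.
  apply: contraNF rz => /eqP <-.
  by rewrite /r root_root //; apply: connect_adjacentC.
transitivity (\sum_(x in component A z) T x); last exact: T0 (mem_components A z).
rewrite [RHS]big_mkcond.
apply: eq_bigr => x _; rewrite inE -[in RHS](root_connect (@connect_adjacentC A)).
by rewrite -[fingraph.root _ z]/(r z) rz eq_sym /r; case: (T x); case: (_ == _).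
Qed.

(** Dropping the edges of a T-join outside [C] is harmless: no edge of [A] leaves [C], and [T]
    vanishes elsewhere. *)
Lemma T_join_in A C (T : vertex G -> bool) :
    C \in components A -> \sum_(x in C) T x = 0 -> (forall x, x \notin C -> T x = false) ->
  exists2 h : edge G -> bool,
    forall e, h e -> (e \in A) && (end1 e \in C) & forall z, boundary h z = T z.
Proof.
move=> CA T0 TC.
have T0' D : D \in components A -> \sum_(x in D) T x = 0.
  move=> DA; have [->//|DC] := eqVneq D C.
  rewrite big1 // => x xD; apply: TC; apply: contraNN DC => xC.
  case/imsetP: CA xC => y _ ->; case/imsetP: DA xD => z _ ->; rewrite !inE => zx yx.
  apply/eqP/setP=> w; rewrite !inE (same_connect (@connect_adjacentC _) zx).
  by rewrite (same_connect (@connect_adjacentC _) yx).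
have [h hA hb] := T_join T0'.
exists (fun e => h e && (end1 e \in C)) => [e /andP[/hA-> ->]//|z].
have [zC|zC] := boolP (z \in C).
  rewrite -hb; apply: eq_boundary => e /orP[] /eqP ez.
    by rewrite ez zC andbT.
  have [he|//] := boolP (h e); by rewrite (component_end CA) ?hA // ez zC.
rewrite TC // /boundary !big1 // => e /eqP ez; have [he|//] := boolP (h e).
  by rewrite (component_end CA) ?hA // ez (negPf zC).
by rewrite ez (negPf zC).
Qed.

End Boundary.
(** * Cubic graphs with a 2-factor *)

Section TwoFactor.
Import GRing.Theory.
Local Open Scope ring_scope.
Variable G : pseudograph.
Hypothesis G_loopless : loopless G.

Lemma degree_incident (F : {set edge G}) x :
  degree F x = #|[set e in F | incident x e]|.
Proof.
rewrite /degree -cardsUI (_ : _ :&: _ = set0) ?cards0 ?addn0.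
  by apply: eq_card => e; rewrite !inE -andb_orr.
apply/setP=> e; rewrite !inE; apply/negP => /andP[/andP[_ /eqP e1] /andP[_ /eqP e2]].
by have := G_loopless e; rewrite e1 e2 eqxx.
Qed.

Lemma boundary_incident (phi : edge G -> bool) x :
  boundary phi x = \sum_(e | incident x e) phi e.
Proof.
rewrite /boundary sum_symdiff; last by case.
apply: eq_bigl => e; rewrite /incident.
have [e1|//] := eqVneq (end1 e) x; have [e2|//] := eqVneq (end2 e) x.
by have := G_loopless e; rewrite e1 e2 eqxx.
Qed.

Definition other (x : vertex G) (e : edge G) : vertex G :=
  if end1 e == x then end2 e else end1 e.

Lemma joins_other (e : edge G) x y : joins e x y = incident x e && (other x e == y).
Proof.
rewrite /joins /incident /other; have [e1|e1] := eqVneq (end1 e) x.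
  have [e2|] := eqVneq (end2 e) x; last by rewrite andbF orbF.
  by have := G_loopless e; rewrite e1 e2 eqxx.
by rewrite /= andbC.
Qed.

Lemma joins_incidentl (e : edge G) x y : joins e x y -> incident x e.
Proof. by rewrite joins_other => /andP[]. Qed.

Lemma joins_incidentr (e : edge G) x y : joins e x y -> incident y e.
Proof. by rewrite joinsC; apply: joins_incidentl. Qed.

Lemma joins_neq (e : edge G) x y : joins e x y -> x != y.
Proof.
by case/orP=> /andP[/eqP <- /eqP <-]; rewrite // eq_sym.
Qed.

Lemma incident_joins (e : edge G) x y z : joins e x y -> incident z e = (z == x) || (z == y).
Proof.
rewrite /incident ![_ == z]eq_sym; case/orP=> /andP[/eqP -> /eqP ->] //.
by rewrite orbC.
Qed.

Lemma sum_true (I : finType) (P : pred I) : \sum_(i | P i) true = odd #|P|.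
Proof. by rewrite sumr_const; elim: #|P| => // n IHn; rewrite mulrS IHn. Qed.

Variable A : {set edge G}.
Hypothesis A_two_factor : two_factor A.
(** [g x] is the spoke at [x], the third edge besides the two of the 2-factor. Cubicity enters this
    section only in this form. *)
Variable g : vertex G -> edge G.
Hypothesis gP : forall x e, (e \notin A) && incident x e = (e == g x).

Lemma g_notin x : g x \notin A.
Proof. by have := gP x (g x); rewrite eqxx => /andP[]. Qed.

Lemma g_incident x : incident x (g x).
Proof. by have := gP x (g x); rewrite eqxx => /andP[]. Qed.

Lemma g_unique x e : e \notin A -> incident x e -> e = g x.
Proof. by move=> eA ex; apply/eqP; rewrite -gP eA. Qed.

Lemma star x d : d \in A -> incident x d ->
  exists d', [/\ d' \in A, d' != d &
    forall e, incident x e = [|| e == d, e == d' | e == g x]].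
Proof.
move=> dA dx; have := A_two_factor x; rewrite degree_incident => D2.
have dD : d \in [set e in A | incident x e] by rewrite inE dA.
have D1 : #|[set e in A | incident x e] :\ d| = 1.
  by move: D2; rewrite (cardsD1 d) dD => -[].
have /cards1P[d' Dd'] := introT eqP D1.
have : d' \in [set e in A | incident x e] :\ d by rewrite Dd' set11.
rewrite !inE => /and3P[d'd d'A _]; exists d'; split=> // e.
have /setP/(_ e) := Dd'; rewrite !inE -gP.
have [->|ed] /= := eqVneq e d; first by rewrite dx.
by move=> <-; case: (e \in A); case: (incident x e).
Qed.

Lemma star_ex x : exists d d', [/\ d \in A, d' \in A, d' != d &
    forall e, incident x e = [|| e == d, e == d' | e == g x]].
Proof.
have := A_two_factor x; rewrite degree_incident => D2.
have /card_gt0P[d] : (0 < #|[set e in A | incident x e]|)%N by rewrite D2.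
rewrite inE => /andP[dA dx]; have [d' [? ? ?]] := star dA dx.
by exists d, d'.
Qed.

Lemma boundary_star (phi : edge G -> bool) x d d' :
    d \in A -> d' \in A -> d' != d ->
    (forall e, incident x e = [|| e == d, e == d' | e == g x]) ->
  boundary phi x = phi d + phi d' + phi (g x).
Proof.
move=> dA d'A d'd Ix; rewrite boundary_incident.
have dg : g x != d by apply: contraNneq (g_notin x) => ->.
have d'g : g x != d' by apply: contraNneq (g_notin x) => ->.
rewrite (bigD1 d) ?Ix ?eqxx //= (bigD1 d') ?Ix ?eqxx ?orbT //= (bigD1 (g x)) /=.
  rewrite big1 ?addr0 ?addrA // => e; rewrite Ix.
  by case: (e == d); case: (e == d'); case: (e == g x).
by rewrite Ix eqxx !orbT dg.
Qed.

Variable C : {set vertex G}.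
Hypothesis CA : C \in components A.

Definition cycle_edges : {set edge G} := [set e in A | end1 e \in C].

Lemma mem_cycle_edges x e : incident x e -> (e \in cycle_edges) = (e \in A) && (x \in C).
Proof.
rewrite inE => /orP[] /eqP <- //.
by have [eA|//] := boolP (e \in A); rewrite (component_end CA).
Qed.

Lemma cycle_edges_ends e : e \in cycle_edges -> (end1 e \in C) && (end2 e \in C).
Proof. by rewrite inE => /andP[eA e1]; rewrite -(component_end CA) // e1. Qed.

Lemma boundary_cycle_edges x : boundary (fun e => e \in cycle_edges) x = 0.
Proof.
have [d [d' [dA d'A d'd Ix]]] := star_ex x.
rewrite (boundary_star _ dA d'A d'd Ix) !(@mem_cycle_edges x) ?Ix ?eqxx ?orbT //.
by rewrite dA d'A (negPf (g_notin x)); case: (x \in C).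
Qed.

Variable v : vertex G.
Hypothesis vC : v \in C.

(** The set [C] minus [v] is even, so the cycle has a join for it. Odd degree at a vertex with two
    cycle edges means degree one, so only [v] needs attention. *)
Lemma near_perfect_matching : odd #|C| ->
  exists M : {set edge G},
    [/\ M \subset cycle_edges, forall d, incident v d -> d \notin M &
        forall x, boundary (fun e => e \in M) x = (x \in C) && (x != v)].
Proof.
move=> oddC.
have [||m mC mb] := T_join_in (T := fun x => (x \in C) && (x != v)) CA.
- rewrite (bigD1 v) //= eqxx andbF add0r.
  rewrite (eq_bigr (fun=> true)) ?sum_true => [|x -> //].
  have -> : #|[pred x in C | x != v]| = #|C :\ v|.
    by apply: eq_card => x; rewrite !inE andbC.
  by move: oddC; rewrite (cardsD1 v) vC add1n /= => /negPf.
- by move=> x /negPf->.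
have [d [d' [dA d'A d'd Iv]]] := star_ex v.
have mA e : e \notin A -> m e = false.
  by move=> eA; apply: contraNF eA => /mC/andP[].
have := mb v; rewrite (boundary_star _ dA d'A d'd Iv) eqxx andbF (mA (g v)) ?g_notin //.
have dC : d \in cycle_edges by rewrite (@mem_cycle_edges v) ?Iv ?eqxx // dA vC.
have d'C : d' \in cycle_edges by rewrite (@mem_cycle_edges v) ?Iv ?eqxx ?orbT // d'A vC.
(* Even degree at [v] leaves two cases: neither or both of its cycle edges are used. In the second,
   the complement within the cycle has the same boundary and avoids [v]. *)
case md: (m d); case md': (m d') => // _; last first.
  exists [set e | m e]; split=> [|e|x].
  - by apply/subsetP=> e; rewrite !inE => /mC.
  - by rewrite Iv inE => /or3P[] /eqP->; rewrite ?md ?md' ?mA ?g_notin.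
  by rewrite -mb; apply: eq_boundary => e _; rewrite inE.
exists [set e | m e + (e \in cycle_edges)]; split=> [|e|x].
- by apply/subsetP=> e; rewrite !inE => /=; case me: (m e); rewrite // mC.
- rewrite Iv inE => /or3P[] /eqP->; rewrite ?md ?md' ?dC ?d'C // mA ?g_notin //.
  by rewrite inE (negPf (g_notin v)).
rewrite -mb -[RHS]addr0 -(boundary_cycle_edges x) -boundaryD.
by apply: eq_boundary => e _; rewrite inE.
Qed.

Lemma card_star (N : {set edge G}) x d d' :
    d \in A -> d' \in A -> d' != d ->
    (forall e, incident x e = [|| e == d, e == d' | e == g x]) ->
  #|[set e in N | incident x e]| = ((d \in N) + (d' \in N) + (g x \in N))%N.
Proof.
move=> dA d'A d'd Ix.
have dg : g x != d by apply: contraNneq (g_notin x) => ->.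
have d'g : g x != d' by apply: contraNneq (g_notin x) => ->.
rewrite -sum1_card (eq_bigl (fun e => incident x e && (e \in N))); last first.
  by move=> e; rewrite inE andbC.
rewrite big_mkcondr (bigD1 d) ?Ix ?eqxx //= (bigD1 d') ?Ix ?eqxx ?orbT //= (bigD1 (g x)) /=.
  rewrite big1 ?addn0 ?addnA => [|e]; first by do 3 case: (_ \in N).
  by rewrite Ix; case: (e == d); case: (e == d'); case: (e == g x).
by rewrite Ix eqxx !orbT dg.
Qed.

Lemma component_closed e x y : e \in A -> joins e x y -> x \in C -> y \in C.
Proof.
move=> eA exy xC; have := mem_cycle_edges (joins_incidentr exy).
by rewrite (mem_cycle_edges (joins_incidentl exy)) eA xC /= => <-.
Qed.

Lemma boundary_pred1_joins (d : edge G) x y z :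
  joins d x y -> boundary (fun e => e == d) z = (z == x) (+) (z == y).
Proof.
rewrite boundary_pred1 ![_ == z]eq_sym; case/orP=> /andP[/eqP-> /eqP->] //.
by rewrite addbC.
Qed.

Lemma incident2_joins (e : edge G) x y : incident x e -> incident y e -> x != y -> joins e x y.
Proof.
rewrite /incident /joins; case: eqP => [->|_] /=.
  by rewrite eq_sym => _ /orP[/eqP->|->//]; rewrite eqxx.
by move/eqP=> ->; rewrite eqxx andbT orbC => /orP[/eqP->|->//]; rewrite eqxx.
Qed.

(** This is the set a(x) of the overview. It is a set without multiplicities: it has a single
    element when both neighbours of [x] share their spoke. *)
Definition spokes_around x := [set g y | y in [set y | adjacent A x y]].

Lemma neighboursE x d d' :
    d \in A -> d' \in A -> (forall e, incident x e = [|| e == d, e == d' | e == g x]) ->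
  [set y | adjacent A x y] = [set other x d; other x d'].
Proof.
move=> dA d'A Ix; apply/setP=> y; rewrite !inE ![y == _]eq_sym.
apply/adjacentP/orP => [[e eA]|].
  rewrite joins_other Ix => /andP[/or3P[] /eqP ee]; rewrite ee in eA *.
  - by left.
  - by right.
  by rewrite (negPf (g_notin x)) in eA.
by case=> oy; [exists d|exists d']; rewrite // joins_other Ix eqxx ?orbT.
Qed.

Lemma spokes_aroundE x d d' :
    d \in A -> d' \in A -> (forall e, incident x e = [|| e == d, e == d' | e == g x]) ->
  spokes_around x = [set g (other x d); g (other x d')].
Proof.
by move=> dA d'A Ix; rewrite /spokes_around (neighboursE dA d'A Ix) imsetU !imset_set1.
Qed.

(** The arcs closing up [S] on the cycle are determined up to complement, and one of the two choices
    contains the prescribed edge [m]. *)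
Lemma arcs (S : {set edge G}) m :
    [disjoint S & A] -> \sum_(x in C) (g x \in S) = 0 -> m \in cycle_edges ->
  exists h : edge G -> bool,
    [/\ forall e, h e -> e \in cycle_edges,
        forall x, x \in C -> boundary h x = (g x \in S) & h m].
Proof.
move=> SA S0 mC.
have [||h hC hb] := T_join_in (T := fun x => (x \in C) && (g x \in S)) CA.
- by rewrite -[RHS]S0; apply: eq_bigr => x ->.
- by move=> x /negPf->.
have [hm|hm] := boolP (h m).
  exists h; split=> // [e /hC|x xC]; first by rewrite inE.
  by rewrite hb xC.
exists (fun e => h e + (e \in cycle_edges)); split=> [e|x xC|].
- by case he: (h e) => // _; rewrite inE hC.
- by rewrite boundaryD boundary_cycle_edges addr0 hb xC.
by rewrite (negPf hm) mC.
Qed.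

Lemma boundary_spokes (S : {set edge G}) x :
  [disjoint S & A] -> boundary (fun e => e \in S) x = (g x \in S).
Proof.
move=> SA; have [d [d' [dA d'A d'd Ix]]] := star_ex x.
rewrite (boundary_star _ dA d'A d'd Ix).
by rewrite (disjointFl SA dA) (disjointFl SA d'A).
Qed.

(* [N] covers [C] except [v], [K] is a cycle through [N], and [S], the set of
   edges outside [A] used by a second cycle space element, can be completed by
   arcs [h] of [C] so that the matching edges near [v] lie in it as well. *)
Lemma side : odd #|C| -> (end1 (g v) \in C) (+) (end2 (g v) \in C) ->
  exists N K : {set edge G},
  [/\ N \subset K,
      forall e, e \in K -> (end1 e \in C) && (end2 e \in C),
      forall x, boundary (fun e => e \in K) x = 0,
      forall x, x \in C -> #|[set e in N | incident x e]| = (x != v) &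
      forall S : {set edge G}, [disjoint S & A] -> g v \in S ->
        \sum_(x in C) (g x \in S) = 0 ->
        \sum_(e in spokes_around v) (e \in S) = true ->
        exists h : edge G -> bool,
          [/\ forall e, h e -> e \in cycle_edges,
              forall x, x \in C -> boundary h x = (g x \in S) &
              forall d x f, d \notin N -> d \in A -> joins d v x ->
                f \in N -> incident x f -> (f \in S) + h f = true]].
Proof.
move=> oddC gvC.
have [d1 [d2 [d1A d2A d21 Iv]]] := star_ex v.
have [M [MC Mv Mb]] := near_perfect_matching oddC.
have MA e : e \in M -> e \in A by move/(subsetP MC); rewrite inE => /andP[].
have vd1 : incident v d1 by rewrite Iv eqxx.
have vd2 : incident v d2 by rewrite Iv eqxx orbT.
have d1C : d1 \in cycle_edges by rewrite (mem_cycle_edges vd1) d1A.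
have d2C : d2 \in cycle_edges by rewrite (mem_cycle_edges vd2) d2A.
rewrite (spokes_aroundE d1A d2A Iv).
set p1 := other v d1; set p2 := other v d2.
have j1 : joins d1 v p1 by rewrite joins_other vd1 eqxx.
have j2 : joins d2 v p2 by rewrite joins_other vd2 eqxx.
(* [M] covers [p] but not by [d], which is incident to [v]; so it uses the other edge of [A] at
   [p]. *)
have Mp d p : d \in A -> joins d v p -> exists m,
    [/\ m \in M, m != d & forall e, incident p e = [|| e == d, e == m | e == g p]].
  move=> dA jd; have [m [mA md Ip]] := star dA (joins_incidentr jd).
  exists m; split=> //; have := Mb p.
  rewrite (component_closed dA jd vC) eq_sym (joins_neq jd) /=.
  rewrite (boundary_star _ dA mA md Ip) (negPf (Mv _ (joins_incidentl jd))).
  have /negPf-> : g p \notin M by apply: contra (g_notin p) => /MA.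
  by case: (m \in M).
have [m1 [m1M m1d1 Ip1]] := Mp _ _ d1A j1.
have [m2 [m2M m2d2 Ip2]] := Mp _ _ d2A j2.
have dvE d x : d \in A -> joins d v x -> d = d1 /\ x = p1 \/ d = d2 /\ x = p2.
  move=> dA; rewrite joins_other Iv => /andP[/or3P[] /eqP ed /eqP<-]; rewrite ed in dA *.
  - by left.
  - by right.
  by rewrite (negPf (g_notin v)) in dA.
(* If the neighbours of [v] have distinct spokes, the near-perfect matching and the whole cycle
   serve as [N] and [K]. *)
have [gp|gp] := eqVneq (g p1) (g p2); last first.
  exists M, cycle_edges; split=> //.
  - exact: cycle_edges_ends.
  - exact: boundary_cycle_edges.
  - move=> x xC; have [a [b [aA bA ba Ix]]] := star_ex x.
    rewrite (card_star _ aA bA ba Ix); have := Mb x; rewrite xC.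
    rewrite (boundary_star _ aA bA ba Ix) /=.
    have /negPf-> : g x \notin M by apply: contra (g_notin x) => /MA.
    have [xv|] := eqVneq x v; last by case: (a \in M); case: (b \in M).
    by rewrite !(negPf (Mv _ _)) // -xv Ix eqxx ?orbT.
  move=> S SA gvS S0; rewrite big_setU1 ?inE //= big_set1 => Sp.
  have [h [hC hb hm]] := arcs SA S0 (subsetP MC _ m1M); exists h; split=> //.
  have hA e : e \notin A -> h e = false.
    by move=> eA; apply: contraNF eA => /hC; rewrite inE => /andP[].
  have SM e : e \in M -> e \in S = false by move=> /MA; apply: disjointFl.
  have p1C := component_closed d1A j1 vC; have p2C := component_closed d2A j2 vC.
  (* Along [m1], [d1], [d2], [m2] the value of [h] flips at each of [p1], [v], [p2] whose spoke is
     in [S]: once at [v], and at exactly one of [p1], [p2]. The two flips cancel. *)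
  have hm2 : h m2.
    have := hb v vC; rewrite (boundary_star _ d1A d2A d21 Iv) (hA _ (g_notin _)) gvS.
    have := hb p1 p1C; rewrite (boundary_star _ d1A (MA _ m1M) m1d1 Ip1) (hA _ (g_notin _)) hm.
    have := hb p2 p2C; rewrite (boundary_star _ d2A (MA _ m2M) m2d2 Ip2) (hA _ (g_notin _)).
    move: Sp; case: (h m2); case: (h d1); case: (h d2); case: (g p1 \in S);
      by case: (g p2 \in S).
  move=> d x f _ dA jd fM xf; rewrite SM // add0r.
  have [[_ xp]|[_ xp]] := dvE d x dA jd; move: xf; rewrite xp ?Ip1 ?Ip2.
    case/or3P=> /eqP ff; rewrite ff // in fM *.
      by rewrite (negPf (Mv _ vd1)) in fM.
    by move: (g_notin p1); rewrite MA.
  case/or3P=> /eqP ff; rewrite ff // in fM *.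
    by rewrite (negPf (Mv _ vd2)) in fM.
  by move: (g_notin p2); rewrite MA.
(* If [d1] and [d2] were parallel, [d2] would have to be the matching edge at [p1], but [M] avoids
   [v]. *)
have p12 : p1 != p2.
  apply/eqP=> p12; have := joins_incidentr j2; rewrite -p12 Ip1 (negPf d21) /=.
  case/orP=> /eqP d2E; first by rewrite -d2E (negPf (Mv _ vd2)) in m1M.
  by rewrite d2E (negPf (g_notin _)) in d2A.
have p1C := component_closed d1A j1 vC; have p2C := component_closed d2A j2 vC.
(* [v], [p1], [p2] form a triangle: match [p1] with [p2] by the chord [c], and
   shortcut [C] by replacing [d1] and [d2] with [c]. *)
set c := g p1.
have cA : c \notin A := g_notin p1.
have jc : joins c p1 p2 by apply: incident2_joins; rewrite // ?g_incident // /c gp g_incident.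
have cgv : c != g v.
  apply: contraTneq gvC => <-; case/orP: jc => /andP[/eqP-> /eqP->].
    by rewrite p1C p2C.
  by rewrite p1C p2C.
have cd1 : c != d1 by apply: contraNneq cA => ->.
have cd2 : c != d2 by apply: contraNneq cA => ->.
have cC : c \notin cycle_edges by rewrite inE (negPf cA).
(* On the path left after deleting [v], each inner vertex has exactly one edge outside [M]. These
   edges match the inner vertices, and [c] matches the two ends. *)
exists (c |: [set e in cycle_edges | [&& e \notin M, e != d1 & e != d2]]).
exists (c |: [set e in cycle_edges | (e != d1) && (e != d2)]).
split.
- by apply: setUS; apply/subsetP=> e; rewrite !inE => /and4P[-> _ -> ->].
- move=> e; rewrite !inE => /orP[/eqP->|/andP[eC _]]; last first.
    by apply: cycle_edges_ends; rewrite inE.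
  by case/orP: jc => /andP[/eqP-> /eqP->]; rewrite p1C p2C.
(* Modulo 2, [K] is the cycle plus the triangle [d1], [d2], [c]. *)
- move=> x; transitivity (boundary (fun e => (e \in cycle_edges) + ((e == d1) + ((e == d2) + (e == c)))) x).
    apply: eq_boundary => e _; rewrite in_setU1 in_set.
    have [->|ed1] := eqVneq e d1; first by rewrite d1C (eq_sym _ d2) (negPf d21) eq_sym (negPf cd1).
    have [->|ed2] := eqVneq e d2; first by rewrite d2C eq_sym (negPf cd2).
    have [->|ec] := eqVneq e c; first by rewrite (negPf cC).
    by rewrite !addr0 andbT.
  rewrite 3!boundaryD boundary_cycle_edges (boundary_pred1_joins _ j1).
  rewrite (boundary_pred1_joins _ j2) (boundary_pred1_joins _ jc).
  by case: (x == v); case: (x == p1); case: (x == p2).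
- move=> x xC.
  have gN : (g x \in c |: [set e in cycle_edges | [&& e \notin M, e != d1 & e != d2]]) =
      (g x == c) by rewrite !inE (negPf (g_notin x)) orbF.
  have cN e : e \in A -> (e \in c |: [set e in cycle_edges | [&& e \notin M, e != d1 & e != d2]]) =
      [&& e \in cycle_edges, e \notin M, e != d1 & e != d2].
    by move=> eA; rewrite in_setU1 in_set; case: eqP eA => // ->; rewrite (negPf cA).
  have [xv|xv] := eqVneq x v.
    rewrite xv in gN *.
    rewrite (card_star _ d1A d2A d21 Iv) gN !cN // (eq_sym _ c) (negPf cgv) !eqxx.
    by rewrite !andbF.
  have [xp1|xp1] := eqVneq x p1.
    rewrite xp1 in gN *.
    rewrite (card_star _ d1A (MA _ m1M) m1d1 Ip1)  gN (cN _ d1A) (cN _ (MA _ m1M)) !eqxx m1M.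
    by rewrite /= !andbF.
  have [xp2|xp2] := eqVneq x p2.
    rewrite xp2 in gN *.
    rewrite (card_star _ d2A (MA _ m2M) m2d2 Ip2) gN (cN _ d2A) (cN _ (MA _ m2M)) -gp !eqxx m2M.
    by rewrite /= !andbF.
  have [a [b [aA bA ba Ix]]] := star_ex x.
  rewrite (card_star _ aA bA ba Ix) gN !cN //.
  have /negPf-> : g x != c.
    apply/negP => /eqP gxc; have := g_incident x; rewrite gxc (incident_joins _ jc).
    by rewrite (negPf xp1) (negPf xp2).
  have xd e : incident x e -> e \in A -> [&& e \in cycle_edges, e \notin M, e != d1 & e != d2] = (e \notin M).
    move=> xe eA; rewrite (mem_cycle_edges xe) eA xC /=; case: (e \in M) => //=.
    apply/andP; split; apply: contraTneq xe => ->.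
      by rewrite (incident_joins _ j1) negb_or xv xp1.
    by rewrite (incident_joins _ j2) negb_or xv xp2.
  rewrite !xd ?Ix ?eqxx ?orbT //.
  have := Mb x; rewrite xC xv (boundary_star _ aA bA ba Ix) /=.
  have /negPf-> : g x \notin M by apply: contra (g_notin x) => /MA.
  by case: (a \in M); case: (b \in M).
(* Now [spokes_around v] is just [c], so the parity assumption says that [c] is in [S]. As [c] is
   the only edge of [N] at [p1] and [p2], any arcs will do, and [d1] is an arbitrary choice. *)
move=> S SA gvS S0; rewrite -/c -gp setUid big_set1 => Sc.
have [h [hC hb _]] := arcs SA S0 d1C; exists h; split=> //.
have hc : h c = false by apply: contraNF cC => /hC.
move=> d x f _ dA jd; rewrite in_setU1 => /orP[/eqP-> _|]; first by rewrite Sc hc.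
rewrite inE => /and4P[fC fM fd1 fd2] xf.
have [[_ xp]|[_ xp]] := dvE d x dA jd; move: xf; rewrite xp ?Ip1 ?Ip2.
  case/or3P=> /eqP ff; rewrite ff in fC fM fd1.
  - by rewrite eqxx in fd1.
  - by rewrite m1M in fM.
  by rewrite (negPf cC) in fC.
case/or3P=> /eqP ff; rewrite ff -?gp in fC fM fd2.
- by rewrite eqxx in fd2.
- by rewrite m2M in fM.
by rewrite (negPf cC) in fC.
Qed.

End TwoFactor.

(** * Gluing the two sides of a crossing edge *)

Section Parity.
Import GRing.Theory.
Local Open Scope ring_scope.
Variable T : finType.
Implicit Types a b X : {set T}.

Lemma sum_pred1 a y : \sum_(e in a) (e == y) = (y \in a).
Proof.
rewrite big_mkcond (bigD1 y) //= eqxx big1 ?addr0; first by case: (y \in a).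
by move=> e /negPf->; case: ifP.
Qed.

Lemma odd_on_two a b : a != set0 -> b != set0 ->
  exists t : T -> bool, \sum_(e in a) t e = true /\ \sum_(e in b) t e = true.
Proof.
move=> /set0Pn[x xa] /set0Pn[y yb].
have [xb|xb] := boolP (x \in b); first by exists (fun e => e == x); rewrite !sum_pred1 xa.
have [ya|ya] := boolP (y \in a); first by exists (fun e => e == y); rewrite !sum_pred1 ya.
exists (fun e => (e == x) + (e == y)); rewrite !big_split /= !sum_pred1.
by rewrite xa yb (negPf xb) (negPf ya).
Qed.

Lemma odd_on_two_and_third a b X y :
    a != set0 -> b != set0 -> y \in X -> y \notin a -> y \notin b ->
  exists t : T -> bool, [/\ \sum_(e in a) t e = true, \sum_(e in b) t e = true &
    \sum_(e in X) t e = true].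
Proof.
move=> a0 b0 yX /negPf ya /negPf yb; have [t [ta tb]] := odd_on_two a0 b0.
have [tX|tX] := boolP (\sum_(e in X) t e); first by exists t.
exists (fun e => t e + (e == y)); rewrite !big_split /= !sum_pred1 ta tb ya yb yX.
by rewrite (negPf tX).
Qed.

(** A system of equations with all right-hand sides 1 over F_2 is unsolvable only if an odd number
    of left-hand sides add up to zero. Here that would mean that [a], [b], [X] or the symmetric
    difference of all three is empty; [y] witnesses that the last is not. *)
Lemma odd_on_three a b X y :
    a != set0 -> b != set0 -> X != set0 -> (y \in X) (+) (y \in a) (+) (y \in b) ->
  exists t : T -> bool, [/\ \sum_(e in a) t e = true, \sum_(e in b) t e = true &
    \sum_(e in X) t e = true].
Proof.
move=> a0 b0 X0.
case yX: (y \in X); case ya: (y \in a); case yb: (y \in b) => // _.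
- by exists (fun e => e == y); rewrite !sum_pred1.
- exact: odd_on_two_and_third a0 b0 yX (negbT ya) (negbT yb).
- have [t []] := odd_on_two_and_third b0 X0 ya (negbT yb) (negbT yX).
  by exists t.
have [t []] := odd_on_two_and_third a0 X0 yb (negbT ya) (negbT yX).
by exists t.
Qed.

End Parity.

(** * Flows from pairs of even subgraphs *)

Section Flow.
Import GRing.Theory.
Local Open Scope ring_scope.
Variable G : pseudograph.

Definition admissible :=
  exists F : {set edge G}, perfect_matching F /\
    exists theta : edge (contract (~: F)) -> Z2xZ2,
      nowhere_zero_flow theta /\ non_conflicting theta.

Lemma boundary_morph (V W : zmodType) (f : V -> W) (phi : edge G -> V) x :
    {morph f : a b / a + b} -> f 0 = 0 ->
  boundary (fun e => f (phi e)) x = f (boundary phi x).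
Proof. by move=> fD f0; rewrite /boundary fD !(big_morph f fD f0). Qed.

Lemma boundary0 (V : zmodType) (phi : edge G -> V) x :
  (forall e, incident x e -> phi e = 0) -> boundary phi x = 0.
Proof. by move=> phi0; rewrite (eq_boundary phi0) /boundary !big1 ?addr0. Qed.

(** The flow is [alpha] times [H1] plus [beta] times [H2]. The last hypothesis keeps an edge lying
    only in [H2] away from one lying only in [H1]. *)
Lemma admissible_of_cycles (F : {set edge G}) (H1 H2 : edge G -> bool) :
    perfect_matching F ->
    (forall x, boundary H1 x = 0) -> (forall x, boundary H2 x = 0) ->
    (forall e, e \in F -> H1 e || H2 e) ->
    (forall e x y f g, e \notin F -> joins e x y -> f \in F -> g \in F ->
       incident x f -> incident y g -> H1 f -> ~~ H2 f -> H2 g -> H1 g) ->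
  admissible.
Proof.
move=> FM b1 b2 F0 nc; exists F; split=> //.
apply: (@flow_on_contraction _ _ (fun e => alpha *+ H1 e + beta *+ H2 e)).
- move=> x; rewrite boundaryD.
  rewrite !(@boundary_morph _ _ (fun b : bool => _ *+ b)) ?b1 ?b2 ?addr0 //.
    by move=> [] [] //; rewrite /= ?addr0 ?add0r // Z2xZ2_char2.
  by move=> [] [] //; rewrite /= ?addr0 ?add0r // Z2xZ2_char2.
- by move=> e /F0; case: (H1 e); case: (H2 e).
move=> e x y f h eF exy fF hF xf yh fa hb.
have := nc e x y f h eF exy fF hF xf yh; move/eqP: fa; move/eqP: hb.
by case: (H1 f); case: (H2 f) => //; case: (H1 h); case: (H2 h) => // _ _ /(_ isT isT isT).
Qed.

End Flow.

(** * Assembly of the matching and the two even subgraphs around a crossing edge *)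

Section Glue.
Import GRing.Theory.
Local Open Scope ring_scope.
Variable G : pseudograph.
Hypothesis G_loopless : loopless G.
Variable A : {set edge G}.
Hypothesis A_two_factor : two_factor A.
Variable g : vertex G -> edge G.
Hypothesis gP : forall x e, (e \notin A) && incident x e = (e == g x).

Lemma spokes_around_neq0 x : spokes_around A g x != set0.
Proof.
have [d [d' [dA d'A _ Ix]]] := star_ex G_loopless A_two_factor gP x.
rewrite (spokes_aroundE G_loopless gP dA d'A Ix).
by apply/set0Pn; exists (g (other x d)); rewrite set21.
Qed.

Variable C : {set vertex G}.
Hypothesis CA : C \in components A.

Definition crossing (e : edge G) := (end1 e \in C) (+) (end2 e \in C).

Lemma crossing_joins e x y : joins e x y -> crossing e = (x \in C) (+) (y \in C).
Proof. by rewrite /crossing; case/orP=> /andP[/eqP-> /eqP->] //; rewrite addbC. Qed.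

(** A neighbour of [x] in [A] lies on the same side of [C] as [x], so it cannot be the other end of
    a crossing spoke. *)
Lemma spokes_around_other x e : crossing (g x) -> e \in spokes_around A g x ->
  e \notin A /\ e != g x.
Proof.
move=> gx /imsetP[y]; rewrite inE => /adjacentP[d dA dxy] ->.
split; first exact: g_notin gP y.
apply: contraTneq gx => gyx.
have jg : joins (g x) x y.
  apply: incident2_joins; first exact: g_incident gP x.
    by rewrite -gyx; apply: g_incident gP y.
  exact: joins_neq dxy.
rewrite (crossing_joins jg).
have := mem_cycle_edges CA (joins_incidentl G_loopless dxy).
by rewrite (mem_cycle_edges CA (joins_incidentr G_loopless dxy)) dA /= => ->; rewrite addbb.
Qed.

Hypothesis CcA : ~: C \in components A.
Hypotheses (oddC : odd #|C|) (oddCc : odd #|~: C|).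

Lemma crossing_setC e : (end1 e \in ~: C) (+) (end2 e \in ~: C) = crossing e.
Proof. by rewrite !inE addbN addNb negbK. Qed.

(** Two of the three odd parities are those required by [side] at [u] and at [v]. The third,
    together with [g u] itself, makes the number of crossing edges in [S] even, so that [S] closes
    up by arcs on both cycles. The element [y] makes the parity conditions solvable. *)
Lemma glue u v y : u \in C -> v \notin C -> g u = g v ->
    [set e | crossing e && (e != g u)] != set0 ->
    (crossing y && (y != g u)) (+) (y \in spokes_around A g u)
      (+) (y \in spokes_around A g v) ->
  admissible G.
Proof.
move=> uC vC guv; set X := [set e | _] => X0 yX.
have juv : joins (g u) u v.
  apply: incident2_joins; first exact: g_incident gP u.
    by rewrite guv; apply: g_incident gP v.
  by apply: contraNneq vC => <-.
have gu : crossing (g u) by rewrite (crossing_joins juv) uC (negPf vC).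
have gv : crossing (g v) by rewrite -guv.
have [|t [ta tb tX]] := @odd_on_three _ (spokes_around A g u) (spokes_around A g v) X y
  (spokes_around_neq0 _) (spokes_around_neq0 _) X0; first by rewrite inE.
(* None of the three sets meets [A] or contains [g u], so forcing [g u] in and discarding [A] leaves
   the parities of [t] intact. *)
pose S := [set e | (e == g u) || (t e && (e \notin A))].
have SA : [disjoint S & A].
  rewrite disjoint_subset; apply/subsetP=> e; rewrite !inE.
  by case/orP=> [/eqP->|/andP[]//]; apply: g_notin gP u.
have guS : g u \in S by rewrite inE eqxx.
have sumS (B : {set edge G}) : (forall e, e \in B -> e \notin A /\ e != g u) ->
    \sum_(e in B) (e \in S) = \sum_(e in B) t e.
  by move=> BA; apply: eq_bigr => e /BA[eA /negPf eg]; rewrite inE eg eA andbT.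
have cross_notin e : crossing e -> e \notin A.
  by apply: contraTN => eA; rewrite /crossing (component_end CA eA) addbb.
have S_cross : \sum_(e | crossing e) (e \in S) = 0.
  rewrite (bigD1 (g u)) //= guS (_ : \sum_(e | _) _ = true) // -tX -sumS.
    by apply: eq_bigl => e; rewrite inE.
  by move=> e; rewrite inE => /andP[/cross_notin].
have addbb2 (b : bool) : b + b = 0 by case: b.
have sum_spokes (B : {set vertex G}) :
    \sum_(x in B) (g x \in S) = \sum_(e | (end1 e \in B) (+) (end2 e \in B)) (e \in S).
  rewrite -(handshake addbb2 (fun e => e \in S)); apply: eq_bigr => x _.
  by rewrite (boundary_spokes G_loopless A_two_factor gP).
have SC : \sum_(x in C) (g x \in S) = 0 by rewrite sum_spokes.
have SCc : \sum_(x in ~: C) (g x \in S) = 0.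
  by rewrite sum_spokes (eq_bigl _ _ crossing_setC).
have Sa : \sum_(e in spokes_around A g u) (e \in S) = true.
  by rewrite sumS // => e; apply: spokes_around_other.
have Sb : \sum_(e in spokes_around A g v) (e \in S) = true.
  by rewrite sumS // => e; rewrite guv; apply: spokes_around_other.
have vCc : v \in ~: C by rewrite inE.
have [N1 [K1 [NK1 KC1 bK1 dN1 /(_ S SA guS SC Sa)[h1 [hC1 bh1 nc1]]]]] :=
  side G_loopless A_two_factor gP CA uC oddC gu.
have gvCc : (end1 (g v) \in ~: C) (+) (end2 (g v) \in ~: C) by rewrite crossing_setC.
have gvS : g v \in S by rewrite -guv.
have [N2 [K2 [NK2 KC2 bK2 dN2 /(_ S SA gvS SCc Sb)[h2 [hC2 bh2 nc2]]]]] :=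
  side G_loopless A_two_factor gP CcA vCc oddCc gvCc.
have inK1 x e : e \in K1 -> incident x e -> x \in C.
  by move=> /KC1/andP[? ?] /orP[] /eqP<-.
have inK2 x e : e \in K2 -> incident x e -> x \notin C.
  by move=> /KC2/andP[]; rewrite !inE => ? ? /orP[] /eqP<-.
have inN1 x e : e \in N1 -> incident x e -> x \in C by move/(subsetP NK1)/inK1; apply.
have inN2 x e : e \in N2 -> incident x e -> x \notin C by move/(subsetP NK2)/inK2; apply.
have h1C x e : incident x e -> x \notin C -> h1 e = false.
  move=> xe; apply: contraNF => /hC1.
  by rewrite (mem_cycle_edges CA xe) => /andP[].
have h2C x e : incident x e -> x \in C -> h2 e = false.
  move=> xe xC; apply: contraTF xC => /hC2.
  by rewrite (mem_cycle_edges CcA xe) inE => /andP[].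
have K12 e : e \in K1 -> e \in K2 -> False.
  by move=> /KC1/andP[e1 _] /KC2/andP[]; rewrite !inE e1.
have K1F e : e \in N1 -> (e \in K1) + (e \in K2) = true.
  move=> /(subsetP NK1) eK; rewrite eK; case eK2: (e \in K2) => //.
  by case: (K12 e eK eK2).
have K2F e : e \in N2 -> (e \in K1) + (e \in K2) = true.
  move=> /(subsetP NK2) eK; rewrite eK; case eK1: (e \in K1) => //.
  by case: (K12 e eK1 eK).
pose F := g u |: (N1 :|: N2).
(* The first subgraph is [S] closed up by the arcs [h1] and [h2]; the second is the disjoint union
   of [K1] and [K2], which contains every edge of [F] but [g u]. *)
apply: (@admissible_of_cycles _ F (fun e => (e \in S) + (h1 e + h2 e))
  (fun e => (e \in K1) + (e \in K2))).
- move=> x; rewrite degree_incident //.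
  have FE : [set e in F | incident x e] =
      [set e | (e == g u) && ((x == u) || (x == v))] :|:
      ([set e in N1 | incident x e] :|: [set e in N2 | incident x e]).
    apply/setP=> e; rewrite !inE -(incident_joins x juv).
    by case: eqP => [->|_] /=; rewrite ?andb_orl //; case: (incident _ _); rewrite ?andbF.
  have [xC|xC] := boolP (x \in C).
    have E2 : [set e in N2 | incident x e] = set0.
      by apply/setP=> e; rewrite !inE; apply/negP=> /andP[eN /(inN2 _ _ eN)]; rewrite xC.
    have xv : (x == v) = false by apply: contraTF xC => /eqP->.
    have := dN1 x xC; rewrite FE E2 setU0 xv orbF; have [->|xu] := eqVneq x u.
      move/cards0_eq->; rewrite setU0 -(cards1 (g u)).
      by apply: eq_card => e; rewrite !inE andbT.
    by move=> /= N_x; rewrite -[RHS]N_x; apply: eq_card => e; rewrite !inE andbF.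
  have E1 : [set e in N1 | incident x e] = set0.
    by apply/setP=> e; rewrite !inE; apply/negP=> /andP[eN /(inN1 _ _ eN)]; apply/negP.
  have xu : (x == u) = false by apply: contraNF xC => /eqP->.
  have xCc : x \in ~: C by rewrite inE.
  have := dN2 x xCc; rewrite FE E1 set0U xu; have [->|xv] := eqVneq x v.
    move/cards0_eq->; rewrite setU0 -(cards1 (g u)).
    by apply: eq_card => e; rewrite !inE andbT.
  by move=> /= N_x; rewrite -[RHS]N_x; apply: eq_card => e; rewrite !inE andbF.
- move=> x; rewrite 2!boundaryD (boundary_spokes G_loopless A_two_factor gP) //.
  have [xC|xC] := boolP (x \in C).
    by rewrite bh1 // (boundary0 (fun e xe => h2C x e xe xC)) addr0 addbb2.
  rewrite bh2 ?inE // (boundary0 (fun e xe => h1C x e xe xC)) add0r.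
  exact: addbb2.
- by move=> x; rewrite boundaryD bK1 bK2.
- move=> e; rewrite !inE => /or3P[/eqP->|/K1F->|/K2F->]; rewrite ?orbT //.
  rewrite eqxx (h1C v) ?(h2C u) //; first exact: g_incident gP u.
  by rewrite guv; apply: g_incident gP v.
move=> d x z f f' dF dxz fF f'F xf zf' _ H2f _.
(* A conflict needs an edge of [F] outside the second subgraph, hence [g u]. It can arise only
   across an edge of [A] at [u] or [v], where [nc1] and [nc2] put the nearby matching edges into the
   first subgraph. *)
have fE : f = g u.
  move: H2f; move: fF; rewrite !inE => /or3P[/eqP->//|/K1F->|/K2F->] //.
have notA : d \notin A -> d = g x by move=> dA; apply: g_unique gP x d dA (joins_incidentl G_loopless dxz).
have xuv : (x == u) || (x == v) by rewrite -(incident_joins x juv) -fE.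
have dA : d \in A.
  apply: contraNT dF => /notA->; rewrite !inE.
  by case/orP: xuv => /eqP->; rewrite -?guv eqxx.
have xz := joins_neq G_loopless dxz.
case/orP: xuv => /eqP xE; rewrite xE in dxz xz.
  have zC := component_closed G_loopless CA dA dxz uC.
  move: f'F; rewrite in_setU1 in_setU => /or3P[/eqP f'g|f'N|/inN2/(_ zf')]; last by rewrite zC.
    move: zf'; rewrite f'g (incident_joins z juv) eq_sym (negPf xz) /= => /eqP zv.
    by rewrite -zv zC in vC.
  rewrite (h2C z) // addr0; apply: (nc1 d z) => //.
  by apply: contraNN dF => dN; rewrite !inE dN orbT.
have zC := component_closed G_loopless CcA dA dxz vCc.
have zC' : z \notin C by rewrite inE in zC.
move: f'F; rewrite in_setU1 in_setU => /or3P[/eqP f'g|/inN1/(_ zf')|f'N]; last 1 first.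
- rewrite (h1C z) // add0r; apply: nc2 dA dxz f'N zf'.
  by apply: contraNN dF => dN; rewrite !inE dN !orbT.
- move: zf'; rewrite f'g (incident_joins z juv) [z == v]eq_sym (negPf xz) orbF => /eqP zu.
  by rewrite zu uC in zC'.
by move=> zC1; rewrite zC1 in zC'.
Qed.

End Glue.

(** * Recognizing the Petersen graph *)

Lemma card_neighbours (T : finType) (r : rel T) (s : seq T) x :
    uniq s -> (forall y, r x y -> y \in s) -> #|[set y | r x y]| = count (r x) s.
Proof.
move=> s_uniq rs; rewrite -size_filter -(card_uniqP (filter_uniq _ s_uniq)).
by apply: eq_card => y; rewrite inE mem_filter; case rxy: (r x y) => //=; rewrite rs.
Qed.

(** If [b] and [e] were related, [c] and [d] would have only each other. So the second neighbour of
    [b] is [c] or [d], and either choice fixes the 5-cycle. *)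
Lemma pentagon_from (T : finType) (r : rel T) (a b c d e : T) (s := [:: a; b; c; d; e]) :
    uniq s -> symmetric r -> irreflexive r ->
    (forall x, x \in s -> #|[set y | r x y]| = 2) ->
    (forall x y, x \in s -> r x y -> y \in s) ->
    r a b -> r a e ->
  exists t, [/\ perm_eq t s, size t = 5 &
    forall x0 i j, i < 5 -> j < 5 ->
      r (nth x0 t i) (nth x0 t j) = (j == i.+1 %% 5) || (i == j.+1 %% 5)].
Proof.
move=> us rC rI deg cl ab ae.
have deg' x : x \in s -> count (r x) s = 2.
  by move=> xs; rewrite -(deg x xs) (card_neighbours us) // => y; apply: cl.
have : all (fun x => count (r x) s == 2) s by apply/allP => x /deg' ->.
rewrite /= !rI !(rC b a) !(rC c a) !(rC d a) !(rC e a) !(rC c b) !(rC d b) !(rC e b).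
rewrite !(rC d c) !(rC e c) !(rC e d) ab ae.
case ac: (r a c); case ad: (r a d); rewrite //=.
case bc: (r b c); case bd: (r b d); case be: (r b e); rewrite ?andbF //;
  case cd: (r c d); case ce: (r c e); case de: (r d e) => //= _.
- exists s; split=> // x0 [|[|[|[|[|//]]]]] [|[|[|[|[|//]]]]] _ _ //=;
  by rewrite ?rI // ?(rC b a) ?(rC c a) ?(rC d a) ?(rC e a) ?(rC c b) ?(rC d b)
    ?(rC e b) ?(rC d c) ?(rC e c) ?(rC e d) ?ab ?ac ?ad ?ae ?bc ?bd ?be ?cd ?ce ?de.
exists [:: a; b; d; c; e]; split=> //.
  by rewrite !perm_cons (perm_catC [:: d] [:: c; e]) /= perm_cons (perm_catC [:: e] [:: d]).
move=> x0 [|[|[|[|[|//]]]]] [|[|[|[|[|//]]]]] _ _ //=;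
  by rewrite ?rI // ?(rC b a) ?(rC c a) ?(rC d a) ?(rC e a) ?(rC c b) ?(rC d b)
    ?(rC e b) ?(rC d c) ?(rC e c) ?(rC e d) ?ab ?ac ?ad ?ae ?bc ?bd ?be ?cd ?ce ?de.
Qed.

(** Two disjoint cycles would need six vertices. The six cases are the possible pairs of neighbours
    of the first vertex, each permuted into the shape wanted by [pentagon_from]. *)
Lemma pentagon (T : finType) (r : rel T) (s : seq T) :
    size s = 5 -> uniq s -> symmetric r -> irreflexive r ->
    (forall x, x \in s -> #|[set y | r x y]| = 2) ->
    (forall x y, x \in s -> r x y -> y \in s) ->
  exists t, [/\ perm_eq t s, size t = 5 &
    forall x0 i j, i < 5 -> j < 5 ->
      r (nth x0 t i) (nth x0 t j) = (j == i.+1 %% 5) || (i == j.+1 %% 5)].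
Proof.
move=> s5 us rC rI deg cl.
have from a b c d e : perm_eq [:: a; b; c; d; e] s -> r a b -> r a e ->
    exists t, [/\ perm_eq t s, size t = 5 & forall x0 i j, i < 5 -> j < 5 ->
      r (nth x0 t i) (nth x0 t j) = (j == i.+1 %% 5) || (i == j.+1 %% 5)].
  move=> ps ab ae.
  have [|||t [tP t5 tr]] := @pentagon_from T r a b c d e _ rC rI _ _ ab ae.
  - by rewrite (perm_uniq ps).
  - by move=> x; rewrite (perm_mem ps); apply: deg.
  - by move=> x y; rewrite !(perm_mem ps); apply: cl.
  by exists t; split=> //; apply: perm_trans ps.
case: s s5 us deg cl from => [|a [|b [|c [|d [|e [|//]]]]]] // _ us deg cl from.
have := deg a (mem_head _ _); rewrite (card_neighbours us); last first.
  by move=> y; apply: cl; apply: mem_head.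
rewrite /= rI.
case ab: (r a b); case ac: (r a c); case ad: (r a d); case ae: (r a e) => // _.
- by apply: (from a b d e c) => //; apply/permP => p /=; do 5 case: (p _).
- by apply: (from a b c e d) => //; apply/permP => p /=; do 5 case: (p _).
- exact: (from a b c d e).
- by apply: (from a c b e d) => //; apply/permP => p /=; do 5 case: (p _).
- by apply: (from a c b d e) => //; apply/permP => p /=; do 5 case: (p _).
by apply: (from a d b c e) => //; apply/permP => p /=; do 5 case: (p _).
Qed.

(** This excludes parallel edges in the Petersen graph, which makes the edge map of the isomorphism
    injective. *)
Lemma petersen_joins_inj (e e' : edge petersen) : joins e (end1 e') (end2 e') -> e = e'.
Proof.
by case: e => [[[[|[|[|[|[|//]]]]] i]|[[|[|[|[|[|//]]]]] i]]|[[|[|[|[|[|//]]]]] i]];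
  case: e' => [[[[|[|[|[|[|//]]]]] j]|[[|[|[|[|[|//]]]]] j]]|[[|[|[|[|[|//]]]]] j]];
  move=> // _; do ?congr inl; do ?congr inr; apply: val_inj.
Qed.

(** * The structure forced when no crossing edge can be glued *)

Section Petersen.
Variable G : pseudograph.
Hypothesis G_loopless : loopless G.
Hypothesis G_cubic : cubic G.
Variable A : {set edge G}.
Hypothesis A_two_factor : two_factor A.
Variable g : vertex G -> edge G.
Hypothesis gP : forall x e, (e \notin A) && incident x e = (e == g x).

Lemma card_edges : (#|edge G|).*2 = 3 * #|vertex G|.
Proof.
have -> : (3 * #|vertex G| = \sum_(x : vertex G) degree [set: edge G] x)%N.
  by rewrite (eq_bigr (fun=> 3)) // sum_nat_const mulnC.
rewrite big_split /= -addnn; congr (_ + _)%N; rewrite -sum1_card.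
  rewrite (partition_big (@end1 G) predT) //; apply: eq_bigr => x _.
  by rewrite -sum1_card; apply: eq_bigl => e; rewrite !inE.
rewrite (partition_big (@end2 G) predT) //; apply: eq_bigr => x _.
by rewrite -sum1_card; apply: eq_bigl => e; rewrite !inE.
Qed.

Definition mate x := other x (g x).

Lemma mate_joins x : joins (g x) x (mate x).
Proof. by rewrite joins_other // (g_incident gP) eqxx. Qed.

Lemma g_mate x : g (mate x) = g x.
Proof.
symmetry; apply: (g_unique gP); first exact: g_notin gP x.
exact: joins_incidentr (mate_joins x).
Qed.

Lemma mateK : involutive mate.
Proof.
move=> x; have := mate_joins (mate x); rewrite g_mate joins_other // => /andP[_ /eqP<-].
by have := mate_joins x; rewrite joinsC joins_other // => /andP[_ /eqP].
Qed.

Lemma eq_g x y : g x = g y -> y = x \/ y = mate x.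
Proof.
move=> gxy; have := g_incident gP y; rewrite -gxy (incident_joins y (mate_joins x)).
by case/orP=> /eqP; [left|right].
Qed.

Lemma adjacent_irr x : adjacent A x x = false.
Proof.
by apply/adjacentP=> -[e _ exx]; have := joins_neq G_loopless exx; rewrite eqxx.
Qed.

Section OneSide.
Variable C : {set vertex G}.
Hypothesis CA : C \in components A.
Hypothesis oddC : odd #|C|.

Lemma adjacent_mem x y : adjacent A x y -> (x \in C) = (y \in C).
Proof.
case/adjacentP=> e eA exy; apply/idP/idP; first exact: (component_closed G_loopless CA eA exy).
by apply: (component_closed G_loopless CA eA); rewrite joinsC.
Qed.

(** If both edges of [A] at [x] led to the same vertex, a near-perfect matching avoiding [x] could
    not cover that vertex. Thus an odd cycle is not a digon. *)
Lemma two_neighbours x : x \in C -> #|[set y | adjacent A x y]| = 2.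
Proof.
move=> xC; have [d [d' [dA d'A d'd Ix]]] := star_ex G_loopless A_two_factor gP x.
have xd : incident x d by rewrite Ix eqxx.
have xd' : incident x d' by rewrite Ix eqxx orbT.
have j : joins d x (other x d) by rewrite joins_other // xd eqxx.
have j' : joins d' x (other x d') by rewrite joins_other // xd' eqxx.
rewrite (neighboursE G_loopless gP dA d'A Ix).
rewrite cards2; case: eqP => //= pp'.
have [M [MC Mx Mb]] := near_perfect_matching G_loopless A_two_factor gP CA xC oddC.
have [d'' [d''A d''d Ip]] := star G_loopless A_two_factor gP dA (joins_incidentr G_loopless j).
have d'E : d' = d''.
  have := joins_incidentr G_loopless j'; rewrite -pp' Ip (negPf d'd) /=.
  by case/orP=> /eqP // d'g; rewrite d'g (negPf (g_notin gP _)) in d'A.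
have := Mb (other x d); rewrite (component_closed G_loopless CA dA j xC).
rewrite eq_sym (joins_neq G_loopless j) (boundary_star G_loopless gP _ dA d''A d''d Ip).
rewrite -d'E (negPf (Mx _ xd)) (negPf (Mx _ xd')).
have /negPf-> // : g (other x d) \notin M.
by apply: contra (g_notin gP (other x d)) => /(subsetP MC); rewrite inE => /andP[].
Qed.

Hypothesis tight : forall u v, u \in C -> v \notin C -> g u = g v -> forall y,
  (crossing C y && (y != g u)) =
  (y \in spokes_around A g u) (+) (y \in spokes_around A g v).

Lemma spokes_aroundP u y : reflect (exists2 z, adjacent A u z & y = g z)
  (y \in spokes_around A g u).
Proof. by apply: (iffP imsetP) => -[z]; rewrite ?inE => ? ?; exists z; rewrite ?inE. Qed.

Lemma crossing_g x : crossing C (g x) = (x \in C) (+) (mate x \in C).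
Proof. exact: crossing_joins (mate_joins x). Qed.

(** The edge [g y] is a spoke around [x]. If it is not one around [mate x], then [tight] makes it
    crossing; if it is, its other end is a neighbour of [mate x] and so lies outside [C]. *)
Lemma crossing_adjacent x y : x \in C -> crossing C (g x) -> adjacent A x y -> crossing C (g y).
Proof.
move=> xC gx xy; have mx : mate x \notin C by move: gx; rewrite crossing_g xC.
have yC : y \in C by rewrite -(adjacent_mem xy).
have gy : g y \in spokes_around A g x by apply/spokes_aroundP; exists y.
have [gy'|gy'] := boolP (g y \in spokes_around A g (mate x)); last first.
  by have := tight xC mx (esym (g_mate x)) (g y); rewrite gy (negPf gy') => /andP[].
case/spokes_aroundP: gy' => z /adjacent_mem mz gyz; rewrite crossing_g yC.
have zC : z \notin C by rewrite -mz.
by have [zE|<-] := eq_g gyz; rewrite ?zE ?yC // in zC *.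
Qed.

Lemma all_crossing x0 x : x0 \in C -> crossing C (g x0) -> x \in C -> mate x \notin C.
Proof.
move=> x0C gx0 xC.
suff : crossing C (g x) by rewrite crossing_g xC.
have x0x : connect (adjacent A) x0 x.
  case/imsetP: CA x0C xC => z _ ->; rewrite !inE => zx0.
  by rewrite (same_connect (@connect_adjacentC _ A) zx0).
have clos : fingraph.closed (adjacent A) [pred y | (y \in C) && crossing C (g y)].
  apply: intro_closed; first exact: connect_adjacentC.
  move=> y z yz /andP[yC gy]; rewrite inE -(adjacent_mem yz) yC.
  exact: crossing_adjacent gy yz.
by have := closed_connect clos x0x; rewrite !inE x0C gx0 => /esym/andP[].
Qed.

End OneSide.
Section TwoSides.
Variable C : {set vertex G}.
Hypotheses (CA : C \in components A) (CcA : ~: C \in components A).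
Hypotheses (oddC : odd #|C|) (oddCc : odd #|~: C|).
Hypothesis tight : forall u v, u \in C -> v \notin C -> g u = g v -> forall y,
  (crossing C y && (y != g u)) =
  (y \in spokes_around A g u) (+) (y \in spokes_around A g v).
Variable x0 : vertex G.
Hypotheses (x0C : x0 \in C) (gx0 : crossing C (g x0)).

Lemma mate_out x : x \in C -> mate x \notin C.
Proof. exact: (all_crossing CA tight x0C gx0). Qed.

(** The tightness condition is symmetric under exchanging [C] with its complement. *)
Lemma mate_in x : x \notin C -> mate x \in C.
Proof.
have tightC u v : u \in ~: C -> v \notin ~: C -> g u = g v -> forall y,
    (crossing (~: C) y && (y != g u)) =
    (y \in spokes_around A g u) (+) (y \in spokes_around A g v).
  rewrite !inE negbK => uC vC guv y; rewrite /crossing crossing_setC guv addbC.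
  exact: tight.
have m0 : mate x0 \in ~: C by rewrite inE mate_out.
have gm0 : crossing (~: C) (g (mate x0)) by rewrite /crossing crossing_setC g_mate.
by have := @all_crossing _ CcA tightC _ x m0 gm0; rewrite !inE negbK.
Qed.

(** By [tight] at the spoke of [x], the crossing edge [g y] lies in exactly one of the two sets of
    surrounding spokes. Membership in them means adjacency of [x] and [y], respectively of their
    mates. *)
Lemma mate_adjacent x y : x \in C -> y \in C -> y != x ->
  adjacent A (mate x) (mate y) = ~~ adjacent A x y.
Proof.
move=> xC yC yx; have gyx : g y != g x.
  apply: contra_neqN yx => /eqP/esym/eq_g[//|yE].
  by have := mate_out xC; rewrite -yE yC.
have := tight xC (mate_out xC) (esym (g_mate x)) (g y).
rewrite gyx (crossing_g C y) yC (negPf (mate_out yC)) /=.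
have -> : (g y \in spokes_around A g x) = adjacent A x y.
  apply/spokes_aroundP/idP => [[z xz /eq_g[<-//|zE]]|xy]; last by exists y.
  have := mate_out yC; rewrite -zE.
  by rewrite -(adjacent_mem CA xz) xC.
have -> : (g y \in spokes_around A g (mate x)) = adjacent A (mate x) (mate y).
  apply/spokes_aroundP/idP => [[z xz /eq_g[zE|<-//]]|xy]; last by exists (mate y); rewrite ?g_mate.
  by have := mate_out xC; rewrite (adjacent_mem CA xz) zE yC.
by case: (adjacent A x y); case: (adjacent A _ _).
Qed.

(** By [mate_adjacent], the rest of [C] splits into the two neighbours of [x0] and the mates of the
    two neighbours of [mate x0]. *)
Lemma card_five : #|C| = 5.
Proof.
have := two_neighbours CA oddC x0C; set N := [set y | _] => cN.
have m0 : mate x0 \in ~: C by rewrite inE mate_out.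
have := two_neighbours CcA oddCc m0; rewrite -(card_imset _ (can_inj mateK)).
set M := mate @: _ => cM.
have MP y : (y \in M) = adjacent A (mate x0) (mate y).
  by rewrite -{1}[y]mateK (mem_imset _ _ (can_inj mateK)) inE.
have NM y : (y \in N) + (y \in M) = ((y \in C) && (y != x0))%N.
  rewrite MP inE; have [yC|yC] := boolP (y \in C).
    have [->|yx] := eqVneq y x0; first by rewrite !adjacent_irr.
    by rewrite mate_adjacent //; case: (adjacent A x0 y).
  have /negPf-> : ~~ adjacent A x0 y by apply: contra yC => /(adjacent_mem CA) <-.
  apply/eqP; rewrite add0n eqb0; apply: contra (mate_out x0C) => /(adjacent_mem CA) ->.
  exact: mate_in.
have NM0 : N :&: M = set0.
  apply/setP=> y; rewrite in_setI in_set0.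
  by have := NM y; case: (y \in N); case: (y \in M); case: (_ && _).
rewrite (cardsD1 x0) x0C (_ : C :\ x0 = N :|: M) ?cardsU ?NM0 ?cards0 ?cN ?cM //.
apply/setP=> y; rewrite in_setU in_setD1 andbC.
by have := NM y; case: (y \in N); case: (y \in M); case: (_ && _).
Qed.

(** The pentagon [u] on [C] is the outer cycle and the mates form the pentagram, since vertices two
    apart on [u] are not adjacent. Maps from the Petersen graph are built first; they are injective,
    hence bijective by counting 10 vertices and 15 edges, and then inverted. *)
Lemma isomorphic_petersen : isomorphic G petersen.
Proof.
have C5 := card_five.
have [||||x xC|x y xC|t [tC t5 tadj]] := @pentagon _ (adjacent A) (enum C).
- by rewrite -cardE.
- exact: enum_uniq.
- exact: adjacent_sym.
- exact: adjacent_irr.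
- by apply: (two_neighbours CA oddC); rewrite mem_enum in xC.
- by move/(adjacent_mem CA); rewrite !mem_enum in xC *; rewrite xC => <-.
pose u (i : 'Z_5) := nth x0 t i.
have uC i : u i \in C.
  by rewrite -mem_enum -(perm_mem tC) mem_nth // t5 ltn_ord.
have u_inj : injective u.
  move=> i j /eqP; rewrite nth_uniq ?t5 ?ltn_ord // => [/eqP/val_inj //|].
  by rewrite (perm_uniq tC) enum_uniq.
pose f (x : vertex petersen) : vertex G :=
  match x with inl i => u i | inr i => mate (u i) end.
have f_inj : injective f.
  move=> [i|i] [j|j] /= fij.
  - by rewrite (u_inj _ _ fij).
  - by have := uC i; rewrite fij (negPf (mate_out (uC j))).
  - by have := uC j; rewrite -fij (negPf (mate_out (uC i))).
  by rewrite (u_inj _ _ (can_inj mateK fij)).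
have cardG : #|vertex G| = 10.
  have CcE : ~: C = mate @: C.
    apply/setP=> x; rewrite inE -{2}[x]mateK (mem_imset _ _ (can_inj mateK)).
    by apply/idP/idP => [/mate_in//|/mate_out]; rewrite mateK.
  by rewrite -(cardsC C) CcE card_imset ?C5 //; apply: can_inj mateK.
have cardZ5 : #|'Z_5| = 5 by rewrite card_ord.
have [f' f'K fK'] : bijective f.
  by apply: inj_card_bij; rewrite // cardG card_sum cardZ5.
have uadj (i : 'Z_5) : adjacent A (u i) (u (i + 1)%R).
  rewrite /u tadj ?ltn_ord //; apply/orP; left.
  by case: i => [[|[|[|[|[|//]]]]] i].
have uadj2 (i : 'Z_5) : adjacent A (mate (u i)) (mate (u (i + 2%:R)%R)).
  rewrite mate_adjacent //; last first.
    by rewrite (inj_eq u_inj); case: i => [[|[|[|[|[|//]]]]] i].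
  by rewrite /u tadj ?ltn_ord //; case: i => [[|[|[|[|[|//]]]]] i].
have /fin_all_exists[h hj] (e : edge petersen) :
    exists d : edge G, joins d (f (end1 e)) (f (end2 e)).
  case: e => [[i|i]|i] /=.
  - by have /adjacentP[d _] := uadj i; exists d.
  - by exists (g (u i)); apply: mate_joins.
  - by have /adjacentP[d _] := uadj2 i; exists d.
have h_inj : injective h.
  move=> e e' hee'; apply: petersen_joins_inj.
  have := hj e; rewrite hee' /joins.
  case/orP: (hj e') => /andP[/eqP-> /eqP->]; rewrite !(inj_eq f_inj);
    by case/orP=> /andP[/eqP<- /eqP<-]; rewrite !eqxx ?orbT.
have [h' h'K hK'] : bijective h.
  apply: inj_card_bij; first by [].
  rewrite -leq_double card_edges cardG !card_sum cardZ5 //.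
exists f', h'; split.
- by exists f.
- by exists h.
move=> e; have := hj (h' e); rewrite hK' /joins.
by case/orP=> /andP[/eqP-> /eqP->]; rewrite !f'K !eqxx ?orbT.
Qed.

End TwoSides.
End Petersen.

(** * Existence of the flow *)

Section Cubic.
Import GRing.Theory.
Local Open Scope ring_scope.
Variable G : pseudograph.
Hypothesis G_loopless : loopless G.
Hypothesis G_cubic : cubic G.
Variable A : {set edge G}.
Hypothesis A_two_factor : two_factor A.

Lemma spoke_exists : exists g : vertex G -> edge G,
  forall x e, (e \notin A) && incident x e = (e == g x).
Proof.
suff ex x : exists d, forall e, (e \notin A) && incident x e = (e == d).
  by have [g gP] := fin_all_exists ex; exists g.
have := G_cubic x; rewrite degree_incident // => I3.
have := A_two_factor x; rewrite degree_incident // => A2.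
have /eqP/cards1P[d Dd] : #|[set e | (e \notin A) && incident x e]| = 1%N.
  have := cardsID A [set e in [set: edge G] | incident x e]; rewrite I3.
  rewrite (_ : _ :&: A = [set e in A | incident x e]) ?A2; last first.
    by apply/setP=> e; rewrite !inE andbC.
  move/(congr1 (subn^~ 2%N)); rewrite addKn => I1; rewrite -[RHS]I1.
  by apply: eq_card => e; rewrite !inE.
by exists d => e; have /setP/(_ e) := Dd; rewrite !inE.
Qed.

Variable g : vertex G -> edge G.
Hypothesis gP : forall x e, (e \notin A) && incident x e = (e == g x).

(** A join of all vertices inside [A] is a perfect matching of its cycles. Adding it to the spokes
    gives an even subgraph, and every edge of [F] gets the value [alpha]. *)
Lemma admissible_even : (forall C, C \in components A -> ~~ odd #|C|) -> admissible G.
Proof.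
move=> evenC; have [|h hA hb] := @T_join _ A (fun=> true).
  by move=> C /evenC/negPf CE; rewrite sum_true CE.
have disj : [disjoint ~: A & A] by rewrite disjoints_subset.
apply: (@admissible_of_cycles _ (~: A) (fun e => (e \in ~: A) + h e) (fun=> false)).
- move=> x; have [d [d' [dA d'A d'd Ix]]] := star_ex G_loopless A_two_factor gP x.
  rewrite degree_incident // (card_star gP _ dA d'A d'd Ix) !inE dA d'A.
  by rewrite (g_notin gP).
- move=> x; rewrite boundaryD (boundary_spokes G_loopless A_two_factor gP) // hb inE.
  by rewrite (g_notin gP).
- by move=> x; apply: boundary0.
- move=> e eA; rewrite eA; rewrite inE in eA.
  by have /negPf-> : ~~ h e by apply: contra eA => /hA.
by [].
Qed.

Variable C : {set vertex G}.
Hypothesis CA : C \in components A.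
Hypothesis oddC : odd #|C|.

(** A cubic graph has evenly many vertices, so the complement of [C] is odd and in particular
    nonempty. If it were not a single component there would be three in all. *)
Lemma setC_component : (#|components A| <= 2)%N ->
  ~: C \in components A /\ odd #|~: C|.
Proof.
move=> le2; have oddCc : odd #|~: C|.
  have := congr1 odd (card_edges G_cubic); rewrite odd_double oddM /= => /esym.
  by rewrite -(cardsC C) oddD oddC /= => /negbFE.
split=> //; have /card_gt0P[y yC] : (0 < #|~: C|)%N by rewrite lt0n; case: #|_| oddCc.
suff -> : ~: C = component A y by apply: mem_components.
have compP z w : (z \in component A w) = (component A z == component A w).
  apply/idP/eqP => [|<-]; last by rewrite inE connect0.
  by rewrite inE => wz; apply/setP=> v; rewrite !inE (same_connect (@connect_adjacentC _ A) wz).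
have memC z : (z \in C) = (component A z == C).
  by case/imsetP: CA => w _ ->; apply: compP.
apply/setP=> z; rewrite inE compP memC.
have yC' : component A y != C by rewrite -memC -in_setC.
apply/idP/eqP => [zC|->//]; apply/eqP; apply: contraTT le2 => zy.
rewrite -ltnNge -(_ : #|[set C; component A y; component A z]| = 3%N).
  by apply/subset_leq_card/subsetP=> B; rewrite !inE => /orP[/orP[]|] /eqP->;
    rewrite ?mem_components.
by rewrite setUC cardsU1 cards2 !inE (negPf zC) (negPf zy) eq_sym yC'.
Qed.

(** Each vertex of [C] has one spoke, so by [handshake] the number of crossing edges has the parity
    of [C]. *)
Lemma odd_crossing : odd #|[set e | crossing C e]|.
Proof.
have addbb2 (b : bool) : b + b = 0 by case: b.
have disj : [disjoint ~: A & A] by rewrite disjoints_subset.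
have := handshake addbb2 (fun e => e \in ~: A) C.
rewrite (eq_bigr (fun=> true)) => [|x _]; last first.
  by rewrite (boundary_spokes G_loopless A_two_factor gP) // inE (g_notin gP).
rewrite sum_true oddC (eq_bigr (fun=> true)) => [|e ce]; last first.
  by rewrite inE; apply: contraTN ce => eA; rewrite (component_end CA eA) addbb.
by rewrite sum_true cardsE => <-.
Qed.

(** With [e0] the two components of [A] are linked and the graph is connected; without it nothing
    leaves [C]. *)
Lemma bridge_of_unique_crossing e0 : ~: C \in components A ->
  (forall e, crossing C e = (e == e0)) -> bridge e0.
Proof.
move=> CcA ce.
have [x [y [xC yC exy]]] : exists x y, [/\ x \in C, y \notin C & joins e0 x y].
  have := ce e0; rewrite eqxx /crossing.
  case e1: (_ \in C); case e2: (_ \in C) => // _.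
    by exists (end1 e0), (end2 e0); rewrite e1 e2 /joins !eqxx.
  by exists (end2 e0), (end1 e0); rewrite e1 e2 /joins !eqxx orbT.
have sub z w : connect (adjacent A) z w -> connect (adjacent [set: edge G]) z w.
  apply: connect_sub => {}z {}w /adjacentP[e _ ezw]; apply: connect1.
  by apply/adjacentP; exists e.
have conn D z w : D \in components A -> z \in D -> w \in D ->
    connect (adjacent [set: edge G]) z w.
  case/imsetP=> v _ ->; rewrite !inE => vz vw; apply: sub.
  by rewrite -(same_connect (@connect_adjacentC _ A) vz).
have xall z : connect (adjacent [set: edge G]) x z.
  have [zC|zC] := boolP (z \in C); first exact: conn CA xC zC.
  apply: (@connect_trans _ _ y); last by apply: conn CcA _ _; rewrite inE.
  by apply: connect1; apply/adjacentP; exists e0.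
rewrite /bridge; apply: (@leq_ltn_trans 1).
  rewrite -(cards1 (component [set: edge G] x)); apply/subset_leq_card/subsetP.
  move=> _ /imsetP[z _ ->]; rewrite inE; apply/eqP/setP=> w; rewrite !inE.
  exact/esym/(same_connect (@connect_adjacentC _ _) (xall z)).
have xy : component [set~ e0] x != component [set~ e0] y.
  apply/eqP=> /setP/(_ y); rewrite !inE connect0.
  suff clos : fingraph.closed (adjacent [set~ e0]) (mem C).
    by move/(closed_connect clos); rewrite /= xC (negPf yC).
  apply: intro_closed; first exact: connect_adjacentC.
  move=> z w /adjacentP[e]; rewrite !inE => ee0 ezw zC.
  by have := crossing_joins C ezw; rewrite ce (negPf ee0) zC /= => /esym/negbFE.
rewrite (_ : 2%N = #|[set component [set~ e0] x; component [set~ e0] y]|).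
  apply/subset_leq_card/subsetP=> B.
  by rewrite !inE => /orP[] /eqP->; apply: mem_components.
by rewrite cards2 xy.
Qed.

End Cubic.

Theorem theorem4 (G : pseudograph) (G_loopless : loopless G) (G_cubic : cubic G)
    (G_bridgeless : bridgeless G)
    (G_two_factor : exists A : {set edge G}, two_factor A /\ #|components A| <= 2)
    (G_not_petersen : ~ isomorphic G petersen) :
  exists F : {set edge G}, perfect_matching F /\
    exists theta : edge (contract (~: F)) -> Z2xZ2,
      nowhere_zero_flow theta /\ non_conflicting theta.
Proof.
have [A [A2 comp2]] := G_two_factor.
have [g gP] := spoke_exists G_loopless G_cubic A2.
have [/existsP[C /andP[CA oddC]]|] := boolP [exists C, (C \in components A) && odd #|C|];
    last first.
  rewrite negb_exists => /forallP evenC; apply: (admissible_even G_loopless A2 gP).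
  by move=> C CA; have := evenC C; rewrite CA.
have [CcA oddCc] := setC_component G_cubic CA oddC comp2.
pose others x := [set e | crossing C e && (e != g x)].
have others_neq0 u v : u \in C -> v \notin C -> g u = g v -> others u != set0.
  move=> uC vC guv; apply/eqP=> /setP oth; apply: (G_bridgeless (g u)).
  apply: (bridge_of_unique_crossing CA) => // e.
  have := oth e; rewrite !inE; have [->|] := eqVneq e (g u); last by rewrite andbT.
  move=> _; rewrite (@crossing_joins _ _ _ u v) ?uC ?(negPf vC) //.
  apply: incident2_joins; first exact: g_incident gP u.
    by rewrite guv; apply: g_incident gP v.
  by apply: contraNneq vC => <-.
pose untight u v y := (y \in others u) (+) (y \in spokes_around A g u)
  (+) (y \in spokes_around A g v).
(* Either some crossing edge meets the solvability test of [glue], or all of them are tight and the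
   graph is the Petersen graph. *)
have [/existsP[u /existsP[v /existsP[y /and4P[uC vC /eqP guv ut]]]]|tight] :=
    boolP [exists u, exists v, exists y,
      [&& u \in C, v \notin C, g u == g v & untight u v y]].
  apply: (glue G_loopless A2 gP CA CcA oddC oddCc uC vC guv (others_neq0 u v uC vC guv)).
  by move: ut; rewrite /untight inE; apply.
case: G_not_petersen.
have /card_gt0P[e0] : 0 < #|[set e | crossing C e]|.
  by rewrite lt0n; have := odd_crossing G_loopless A2 gP CA oddC; case: #|_|.
rewrite inE => ce0.
have e0A : e0 \notin A.
  by apply: contraTN ce0 => eA; rewrite /crossing (component_end CA eA) addbb.
have [x xC gx] : exists2 x, x \in C & crossing C (g x).
  have gE z : incident z e0 -> crossing C (g z).
    by move=> ze; rewrite -(g_unique gP e0A ze).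
  move: ce0; rewrite /crossing; case e1: (end1 e0 \in C).
    by exists (end1 e0) => //; apply: gE; rewrite /incident eqxx.
  by move=> e2; exists (end2 e0) => //; apply: gE; rewrite /incident eqxx orbT.
apply: (isomorphic_petersen G_loopless G_cubic A2 gP CA CcA oddC oddCc _ xC gx).
move=> u v uC vC guv y; move: tight.
rewrite negb_exists => /forallP/(_ u); rewrite negb_exists => /forallP/(_ v).
rewrite negb_exists => /forallP/(_ y); rewrite uC vC (introT eqP guv) /untight inE /=.
by case: (_ && _); case: (_ \in _); case: (_ \in _).
Qed.
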